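(* Let $\mathbb{F}$ be a field of characteristic different from $2$, let $G\leq\mathrm{GL}_n(\mathbb{F})$ be a reflection group acting on $V=\mathbb{F}^n$, and let $\chi:G\to\mathbb{F}^\times$ be a linear character. Suppose $\omega_1,\dots,\omega_n$ are $\chi$-invariant $1$-forms with $$\omega_1\wedge\cdots\wedge\omega_n=c\,Q(\tilde{\mathcal A}_\chi)\,Q_\chi^{\,n-1}\,Q_{\chi\cdot\det}\,dz_1\wedge\cdots\wedge dz_n$$ for some $c\in\mathbb{F}^\times$. Then $\omega_1,\dots,\omega_n$ is a basis of the module $(\Omega^1)^G_\chi$ of $\chi$-invariant $1$-forms as a free module over $\mathbb{F}[V]^G$: $(\Omega^1)^G_\chi=\bigoplus_i\mathbb{F}[V]^G\,\omega_i$.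
   Context: $\mathbb{F}[V]=S(V^* )$; $z_1,\dots,z_n$ is a basis of $V^*$; $\Omega^1=\mathbb{F}[V]\otimes V^*$, with $G$ acting on $V^*$ by $(gf)(v)=f(g^{-1}v)$ and diagonally on forms. $(\Omega^1)^G_\chi=\{\omega\in\Omega^1: g\omega=\chi(g)\omega\ \forall g\in G\}$. A reflection is a finite-order element of $\mathrm{GL}(V)$ whose fixed space is a hyperplane; a reflection group is a finite group generated by reflections. For a hyperplane $H$ with defining linear form $l_H$, a reflection $s$ about $H$ satisfies $s(v)=v+l_H(v)\alpha_s$ (root vector $\alpha_s$); it is a transvection if $\alpha_s\in H$, diagonalizable otherwise. $\mathcal A$ is the set of reflecting hyperplanes of reflections in $G$. For $H\in\mathcal A$: $G_H$ is the pointwise stabilizer of $H$ in $G$, $K_H=\ker(\det|_{G_H})$, $e_H=|G_H:K_H|$, $G_H$ is generated by $K_H$ and a diagonalizable reflection $s_H$ of order $e_H$ ($s_H=1$ if $e_H=1$), and $b_H$ is the dimension of the span of the root vectors of transvections in $G_H$. For a linear character $\psi$ of $G$, $Q_\psi=\prod_{H\in\mathcal A}l_H^{a_H(\psi)}$, where $a_H(\psi)$ is the smallest nonnegative integer with $\psi(s_H)=\det(s_H)^{-a_H(\psi)}$. Finally $Q(\tilde{\mathcal A}_\chi)=\prod_{H\in\mathcal A,\ \chi(s_H)=1}l_H^{e_Hb_H}$. *)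

(* Defs.v *)
From HB Require Import structures.
From mathcomp Require Import all_boot all_order all_algebra all_fingroup.
From mathcomp Require Import mxrepresentation.
From mathcomp Require Import mpoly.

Set Implicit Arguments.
Unset Strict Implicit.
Unset Printing Implicit Defensive.

Import GRing.Theory.
Local Open Scope ring_scope.

(* Conventions.
   * G <= GL_n(F) is modelled by a finite group G with a faithful matrix
     representation rG; V = F^n consists of COLUMN vectors and g acts by
     v |-> rG g *m v (a left action, since rG (x * y) = rG x *m rG y).
   * A linear form l in V^* is a row vector, l(v) = l *m v; the coordinate
     form z_i is the i-th unit row vector and corresponds to the variable 'X_i
     of F[V] = S(V^* ) = {mpoly F[n]}.
   * Subspaces of V are stored (mxalgebra style) as row spaces of matrices
     whose rows are the transposes of the spanning column vectors.
   * A 1-form  sum_i p_i dz_i  is the row vector (p_1, ..., p_n). *)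

Section ReflectionData.
Variables (F : fieldType) (gT : finGroupType) (G : {group gT}) (n : nat).
Variable rG : mx_representation F G n.

Definition fixsp (g : gT) : 'M[F]_n := kermx (rG g - 1%:M)^T.

(* g is a reflection: its fixed space is a hyperplane (finite order is
   automatic in the finite group G) *)
Definition is_refl (g : gT) : bool := (\rank (fixsp g)).+1 == n.

Definition reflections : {set gT} := [set g in G | is_refl g].

(* a reflection s(v) = v + l_H(v) alpha_s is a transvection iff its root
   vector alpha_s (which spans the column space of rG s - 1) lies in H *)
Definition is_transv (g : gT) : bool :=
  is_refl g && ((rG g - 1%:M)^T <= fixsp g)%MS.

Definition hyps : seq 'M[F]_n :=
  undup [seq <<fixsp r>>%MS | r <- enum reflections].

Definition GH (H : 'M[F]_n) : {set gT} := [set g in G | (H <= fixsp g)%MS].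

Definition KH (H : 'M[F]_n) : {set gT} := [set g in GH H | \det (rG g) == 1].

Definition eH (H : 'M[F]_n) : nat := #|GH H : KH H|%g.

(* s_H : a diagonalizable reflection of order e_H with G_H = <K_H, s_H>;
   s_H = 1 if no such element exists (i.e. if e_H = 1) *)
Definition sH (H : 'M[F]_n) : gT :=
  odflt 1%g [pick s in GH H | [&& is_refl s, ~~ is_transv s, #[s]%g == eH H
                               & (<<KH H :|: [set s]>>%g == GH H)]].

Definition bH (H : 'M[F]_n) : nat :=
  \rank (\sum_(t in GH H | is_transv t) (rG t - 1%:M)^T)%MS.

(* a_H(psi) = least a >= 0 with psi(s_H) = det(s_H)^(-a); such an a, when
   it exists, is smaller than the order of det(s_H), hence <= #|G|, so the
   search range below is exhaustive *)
Definition aH (psi : gT -> F) (H : 'M[F]_n) : nat :=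
  find (fun a : nat => psi (sH H) == (\det (rG (sH H))) ^- a) (iota 0 #|G|.+1).

Definition lH (H : 'M[F]_n) : 'rV[F]_n := nz_row (kermx H^T).

Definition lpoly (l : 'rV[F]_n) : {mpoly F[n]} := \sum_(i < n) l 0 i *: 'X_i.

Definition Qpsi (psi : gT -> F) : {mpoly F[n]} :=
  \prod_(H <- hyps) lpoly (lH H) ^+ aH psi H.

Definition Qtilde (chi : gT -> F) : {mpoly F[n]} :=
  \prod_(H <- hyps | chi (sH H) == 1) lpoly (lH H) ^+ (eH H * bH H).

(* action on F[V]: (g p)(v) = p(g^-1 v), i.e. z_i |-> row i of rG g^-1 *)
Definition actp (g : gT) (p : {mpoly F[n]}) : {mpoly F[n]} :=
  comp_mpoly [tuple lpoly (row i (rG g^-1%g)) | i < n] p.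

(* diagonal action on 1-forms: g (sum_i p_i dz_i) = sum_i (g p_i) (g z_i) *)
Definition actf (g : gT) (w : 'rV[{mpoly F[n]}]_n) : 'rV[{mpoly F[n]}]_n :=
  map_mx (actp g) w *m map_mx (fun a : F => a%:MP) (rG g^-1%g).

Definition G_invariant_poly (p : {mpoly F[n]}) : Prop :=
  forall g, g \in G -> actp g p = p.

Definition chi_invariant_form (chi : gT -> F) (w : 'rV[{mpoly F[n]}]_n) : Prop :=
  forall g, g \in G -> actf g w = (chi g)%:MP *: w.

End ReflectionData.

Definition lin_char (F : fieldType) (gT : finGroupType) (G : {group gT})
  (chi : gT -> F) : Prop :=
  {in G &, {morph chi : x y / (x * y)%g >-> x * y}} /\ {in G, forall g, chi g != 0}.

(* Main.v *)
Require Import Defs.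
From HB Require Import structures.
From mathcomp Require Import all_boot all_order all_algebra all_fingroup.
From mathcomp Require Import cyclic mxrepresentation.
From mathcomp Require Import mpoly ring.
Import GRing.Theory.
Local Open Scope ring_scope.

(* Let L be the product of powers of the l_H on the right-hand side of the
   hypothesis. The point is that L divides \det W for ANY n chi-invariant
   forms; then, by Cramer's rule, the coefficients of a chi-invariant form on
   the rows of W are polynomials, and they are G-invariant by uniqueness.
   Since the l_H are pairwise coprime primes, divisibility is checked one
   hyperplane at a time, by evaluating the forms on a basis of V adapted to H.
   Evaluated at a vector of H, a form gives a chi-semi-invariant of s_H, and
   evaluated at an eigenvector of s_H outside H it gives a
   (chi * det)-semi-invariant; this accounts for the exponents a_H. When
   chi(s_H) = 1, the value at the root vector of a transvection in G_H
   moreover vanishes on H, and being s_H-invariant it is divisible by l_H^e_H,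
   whence the extra e_H * b_H. *)

(** * Divisibility in commutative rings, and determinants *)

Section Divides.
Set Implicit Arguments.
Unset Strict Implicit.
Variable R : comNzRingType.
Implicit Types p q r : R.

Definition divides p q := exists r, q = r * p.

Lemma divides0 p : divides p 0.
Proof. by exists 0; rewrite mul0r. Qed.

Lemma divides1 p : divides 1 p.
Proof. by exists p; rewrite mulr1. Qed.

Lemma divides_refl p : divides p p.
Proof. by exists 1; rewrite mul1r. Qed.

Lemma dividesD p q r : divides p q -> divides p r -> divides p (q + r).
Proof. by move=> [a ->] [b ->]; exists (a + b); rewrite mulrDl. Qed.

Lemma dividesMl p q r : divides p q -> divides p (r * q).
Proof. by move=> [a ->]; exists (r * a); rewrite mulrA. Qed.

Lemma dividesMr p q r : divides p q -> divides p (q * r).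
Proof. by rewrite mulrC; apply: dividesMl. Qed.

Lemma dividesN p q : divides p q -> divides p (- q).
Proof. by rewrite -mulN1r; apply: dividesMl. Qed.

Lemma divides_sum p (I : Type) (s : seq I) (P : pred I) (E : I -> R) :
  (forall i, P i -> divides p (E i)) -> divides p (\sum_(i <- s | P i) E i).
Proof.
by move=> pE; elim/big_ind: _ => //; [apply: divides0 | apply: dividesD].
Qed.

Lemma divides_mulmx p m k l (A : 'M[R]_(m, k)) (B : 'M[R]_(k, l)) :
  (forall i j, divides p (A i j)) -> forall i j, divides p ((A *m B) i j).
Proof.
move=> pA i j; rewrite mxE; apply: divides_sum => t _.
exact/dividesMr/pA.
Qed.

(** Pulling [p ^+ k j] out of column [j] factors [M] through a diagonal matrix whose determinant is
    the required power. *)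
Lemma divides_det m (M : 'M[R]_m) p (k : 'I_m -> nat) :
  (forall i j, divides (p ^+ k j) (M i j)) ->
  divides (p ^+ (\sum_j k j)) (\det M).
Proof.
move=> pM.
have /fin_all_exists [f fP] i : exists fi, forall j, M i j = fi j * p ^+ k j.
  by have /fin_all_exists := pM i.
exists (\det (\matrix_(i, j) f i j)).
rewrite -prodrXr.
have -> : M = (\matrix_(i, j) f i j) *m diag_mx (\row_j p ^+ k j).
  by apply/matrixP => i j; rewrite mul_mx_diag !mxE fP.
rewrite det_mulmx det_diag; congr (_ * _).
by apply: eq_bigr => j _; rewrite mxE.
Qed.

End Divides.

(** The bordered matrix with blocks [1], [-l], [a], [1] has two block-triangular factorizations;
    comparing determinants gives the formula. *)
Lemma det_add_col_row {R : comNzRingType} {n : nat}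
    (a : 'cV[R]_n) (l : 'rV[R]_n) :
  \det (1%:M + a *m l) = 1 + (l *m a) 0 0.
Proof.
have e1 : block_mx 1%:M (- l) a 1%:M =
    block_mx 1%:M 0 a 1%:M *m block_mx 1%:M (- l) 0 (1%:M + a *m l).
  rewrite mulmx_block ?(mul1mx, mul0mx, mulmx1, mulmx0, addr0).
  by rewrite mulmxN addrCA addNr addr0.
have e2 : block_mx 1%:M (- l) a 1%:M =
    block_mx (1%:M + l *m a) (- l) 0 1%:M *m block_mx 1%:M 0 a 1%:M.
  rewrite mulmx_block ?(mul1mx, mul0mx, mulmx1, mulmx0, add0r, addr0).
  by rewrite mulNmx addrK.
have := congr1 determinant e1; rewrite e2 !det_mulmx !det_lblock !det_ublock.
by rewrite !det1 !mul1r !mulr1 det_mx11 !mxE eqxx.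
Qed.

(** * Linear substitutions, and linear forms as primes of the polynomial ring *)

Section LinearSubstitution.
Set Implicit Arguments.
Unset Strict Implicit.
Variables (F : fieldType) (n : nat).
Implicit Types (M : 'M[F]_n) (l : 'rV[F]_n) (b : 'cV[F]_n) (p q : {mpoly F[n]}).

(** [actp rG g] unfolds to [subst (rG g^-1%g)], so ring morphism lemmas become available for the
    group action. *)
Definition subst M p : {mpoly F[n]} :=
  comp_mpoly [tuple lpoly (row i M) | i < n] p.

HB.instance Definition _ M := 
  GRing.RMorphism.copy (subst M)
    (comp_mpoly [tuple lpoly (row i M) | i < n]).

Notation cmx := (map_mx (@mpolyC n F)).

Lemma substC M (a : F) : subst M a%:MP = a%:MP.
Proof. exact: comp_mpolyC. Qed.

Lemma substZ M (a : F) p : subst M (a *: p) = a *: subst M p.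
Proof. exact: comp_mpolyZ. Qed.

Lemma substX M i : subst M 'X_i = lpoly (row i M).
Proof. by rewrite /subst comp_mpolyXU -tnth_nth tnth_mktuple. Qed.

Lemma subst_cmx M k m (A : 'M_(k, m)) : map_mx (subst M) (cmx A) = cmx A.
Proof. by apply/matrixP => i j; rewrite !mxE substC. Qed.

Lemma lpolyD l l' : lpoly (l + l') = lpoly l + lpoly l'.
Proof.
by rewrite /lpoly -big_split; apply: eq_bigr => i _; rewrite mxE scalerDl.
Qed.

Lemma lpolyZ (a : F) l : lpoly (a *: l) = a *: lpoly l.
Proof.
by rewrite /lpoly scaler_sumr; apply: eq_bigr => i _; rewrite mxE scalerA.
Qed.

Lemma lpoly_coef l i : (lpoly l)@_U_(i) = l 0 i.
Proof.
rewrite /lpoly raddf_sum (bigD1 i) //= mcoeffZ mcoeffXU eqxx mulr1.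
rewrite big1 ?addr0 // => j ji.
by rewrite mcoeffZ mcoeffXU (negbTE ji) mulr0.
Qed.

Lemma lpoly_inj : injective (@lpoly F n).
Proof. by move=> l l' e; apply/rowP => i; rewrite -!lpoly_coef e. Qed.

Lemma lpoly0 : lpoly (0 : 'rV[F]_n) = 0.
Proof. by rewrite -(scale0r 0) lpolyZ scale0r. Qed.

Lemma lpoly_eq0 l : (lpoly l == 0) = (l == 0).
Proof. by rewrite -lpoly0 (inj_eq lpoly_inj). Qed.

Lemma lpoly_delta i : lpoly (row i (1%:M : 'M[F]_n)) = 'X_i.
Proof.
rewrite /lpoly (bigD1 i) //= !mxE eqxx scale1r big1 ?addr0 // => j ji.
by rewrite !mxE eq_sym (negbTE ji) scale0r.
Qed.

Lemma subst_lpoly M l : subst M (lpoly l) = lpoly (l *m M).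
Proof.
rewrite {1}/lpoly rmorph_sum /=.
under eq_bigr => i _ do rewrite substZ substX -lpolyZ.
rewrite mulmx_sum_row; elim/big_rec2: _ => [|i x y _ ->]; first by rewrite lpoly0.
by rewrite lpolyD.
Qed.

(** Each variable moves by a multiple of [lpoly l], and congruence modulo [lpoly l] passes to
    products, hence to monomials and their combinations. *)
Lemma subst_mod b l p : divides (lpoly l) (subst (1%:M + b *m l) p - p).
Proof.
set M := 1%:M + _.
have mulP q r : divides (lpoly l) (subst M q - q) ->
    divides (lpoly l) (subst M r - r) -> divides (lpoly l) (subst M (q * r) - q * r).
  move=> dq dr; rewrite rmorphM /=.
  have -> : subst M q * subst M r - q * r =
    (subst M q - q) * subst M r + q * (subst M r - r).
    by rewrite mulrBl mulrBr addrA subrK.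
  by apply: dividesD; [apply: dividesMr | apply: dividesMl].
rewrite [p]mpolyE rmorph_sum -sumrB; apply: divides_sum => m _ /=.
rewrite substZ -scalerBr -mul_mpolyC; apply: dividesMl.
rewrite mpolyXE_id; elim/big_ind: _ => //.
  by rewrite rmorph1 subrr; apply: divides0.
move=> i _; elim: (m i) => [|k IHk].
  by rewrite expr0 rmorph1 subrr; apply: divides0.
rewrite exprS; apply: mulP => //.
rewrite substX /M linearD /= lpolyD lpoly_delta addrAC subrr add0r.
rewrite row_mul [row i b]mx11_scalar mul_scalar_mx lpolyZ -mul_mpolyC.
exact/dividesMl/divides_refl.
Qed.

Lemma exists_dual_vector l : l != 0 -> exists b : 'cV[F]_n, l *m b = 1%:M.
Proof. by move=> l0; apply/row_freeP; rewrite /row_free rank_rV l0. Qed.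

(* Substitution by the projection 1 - b l restricts p to the hyperplane l = 0,
   so divisibility by l amounts to lying in the kernel of a ring morphism. *)
Lemma divides_lpoly b l p : l *m b = 1%:M ->
  divides (lpoly l) p <-> subst (1%:M - b *m l) p = 0.
Proof.
move=> lb; split=> [[r ->]|p0].
  rewrite rmorphM /= subst_lpoly mulmxBr mulmx1 mulmxA lb mul1mx subrr lpoly0.
  by rewrite mulr0.
rewrite -[p]opprK -[- p]add0r -p0 -mulNmx; exact/dividesN/subst_mod.
Qed.

Lemma lpoly_ndvd1 l : l != 0 -> ~ divides (lpoly l) 1.
Proof.
case/exists_dual_vector => b lb /(divides_lpoly _ lb).
by rewrite rmorph1 => /eqP; rewrite oner_eq0.
Qed.

(** The kernel of a ring morphism into a domain is a prime ideal. *)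
Lemma lpoly_prime l p q : l != 0 ->
  divides (lpoly l) (p * q) -> divides (lpoly l) p \/ divides (lpoly l) q.
Proof.
case/exists_dual_vector => b lb /(divides_lpoly _ lb); rewrite rmorphM /= => /eqP.
by rewrite mulf_eq0 => /orP[] /eqP /(divides_lpoly _ lb); [left | right].
Qed.

(** The projection sends [l'] to [l'] minus [l'(b)] times [l]. *)
Lemma divides_lpoly_lpoly l l' : l != 0 ->
  divides (lpoly l) (lpoly l') -> exists a : F, l' = a *: l.
Proof.
case/exists_dual_vector => b lb /(divides_lpoly _ lb).
rewrite subst_lpoly -lpoly0 => /lpoly_inj/eqP.
rewrite mulmxBr mulmx1 subr_eq0 mulmxA => /eqP ->.
by exists ((l' *m b) 0 0); rewrite {1}[l' *m b]mx11_scalar mul_scalar_mx.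
Qed.

(** Primality puts a factor [lpoly l] into [q]; cancelling it lowers [k]. *)
Lemma divides_lpolyX_mul l p q k : l != 0 -> ~ divides (lpoly l) p ->
  divides (lpoly l ^+ k) (q * p) -> divides (lpoly l ^+ k) q.
Proof.
move=> l0 ldvdp; elim: k q => [|k IHk] q; first by rewrite expr0 => _; apply: divides1.
move=> [r e]; have : divides (lpoly l) (q * p).
  by rewrite e exprS mulrCA; exists (r * lpoly l ^+ k); rewrite mulrC.
case/(lpoly_prime l0) => // -[q' q'E].
have L0 : lpoly l != 0 by rewrite lpoly_eq0.
have /IHk[r' r'E] : divides (lpoly l ^+ k) (q' * p).
  exists r; apply: (mulfI L0); rewrite mulrA [lpoly l * q']mulrC -q'E e exprS.
  by rewrite mulrCA.
by exists r'; rewrite q'E r'E exprSr mulrA.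
Qed.

Lemma divides_lpolyX l p m : l != 0 ->
  ~ divides (lpoly l) p -> ~ divides (lpoly l) (p ^+ m).
Proof.
move=> l0 lp; elim: m => [|m IHm]; first exact: lpoly_ndvd1.
by rewrite exprS => /(lpoly_prime l0)[].
Qed.

(** By induction the product over the tail divides [p]. No form of the tail is proportional to the
    head form, so the head power must divide the remaining quotient. *)
Lemma divides_prod_lpoly (I : eqType) (s : seq I) (l : I -> 'rV[F]_n)
    (k : I -> nat) p :
  uniq s -> {in s, forall i, l i != 0} ->
  {in s &, forall i j (a : F), l i = a *: l j -> i = j} ->
  {in s, forall i, divides (lpoly (l i) ^+ k i) p} ->
  divides (\prod_(i <- s) lpoly (l i) ^+ k i) p.
Proof.
elim: s p => [|i s IHs] p /=; first by rewrite big_nil => *; apply: divides1.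
case/andP => is_ us l0 linj dp.
have sub j : j \in s -> j \in i :: s by rewrite inE orbC => ->.
have [r rE] : divides (\prod_(j <- s) lpoly (l j) ^+ k j) p.
  apply: IHs => // [j /sub /l0 //|j j' /sub js /sub j's|j /sub /dp //].
  exact: linj.
have li0 : l i != 0 by apply/l0/mem_head.
suff [r' r'E] : divides (lpoly (l i) ^+ k i) r.
  by exists r'; rewrite rE r'E big_cons mulrA.
have := dp i (mem_head _ _); rewrite rE; apply: divides_lpolyX_mul => //.
rewrite big_seq; elim/big_ind: _ => //.
- exact: lpoly_ndvd1.
- by move=> x y dx dy /(lpoly_prime li0)[].
- move=> j js; apply: divides_lpolyX => //.
  move=> /(divides_lpoly_lpoly li0)[a e].
  have ji := linj j i (sub j js) (mem_head _ _) a e.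
  by rewrite -ji js in is_.
Qed.

End LinearSubstitution.

(** * Reflecting hyperplanes, their linear forms and pointwise stabilizers *)

Section Hyperplanes.
Set Implicit Arguments.
Unset Strict Implicit.
Variables (F : fieldType) (gT : finGroupType) (G : {group gT}) (n : nat).
Variable rG : mx_representation F G n.
Implicit Types (g t : gT) (H : 'M[F]_n).

Lemma mem_GH H g : (g \in GH rG H) = (g \in G) && (H *m (rG g)^T == H).
Proof.
by rewrite inE /fixsp sub_kermx linearB /= trmx1 mulmxBr mulmx1 subr_eq0.
Qed.

Lemma GH_sub H : GH rG H \subset G.
Proof. by apply/subsetP => g; rewrite mem_GH => /andP[]. Qed.

Lemma group_set_GH H : group_set (GH rG H).
Proof.
apply/group_setP; split=> [|x y]; first by rewrite mem_GH group1 repr_mx1 trmx1 mulmx1 eqxx.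
rewrite !mem_GH => /andP[xG /eqP xH] /andP[yG /eqP yH].
by rewrite groupM //= repr_mxM // trmx_mul mulmxA yH xH.
Qed.
Canonical GH_group H := Group (group_set_GH H).

Lemma mem_KH H g : (g \in KH rG H) = (g \in GH rG H) && (\det (rG g) == 1).
Proof. by rewrite inE. Qed.

Lemma group_set_KH H : group_set (KH rG H).
Proof.
apply/group_setP; split=> [|x y]; first by rewrite mem_KH group1 repr_mx1 det1 eqxx.
rewrite !mem_KH => /andP[xG /eqP xH] /andP[yG /eqP yH].
by rewrite groupM //= repr_mxM ?(subsetP (GH_sub H)) // det_mulmx xH yH mulr1.
Qed.
Canonical KH_group H := Group (group_set_KH H).

Lemma repr_detM : {in G &, forall x y, \det (rG (x * y)%g) = \det (rG x) * \det (rG y)}.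
Proof. by move=> x y xG yG; rewrite repr_mxM // det_mulmx. Qed.

Lemma repr_detX g k : g \in G -> \det (rG (g ^+ k)%g) = \det (rG g) ^+ k.
Proof.
move=> gG; elim: k => [|k IHk]; first by rewrite repr_mx1 det1.
by rewrite expgS repr_detM ?groupX // IHk exprS.
Qed.

Lemma repr_det_neq0 g : g \in G -> \det (rG g) != 0.
Proof. by move=> gG; have := repr_mx_unit rG gG; rewrite unitmxE unitfE. Qed.

Lemma repr_detV g : g \in G -> \det (rG g^-1%g) = (\det (rG g))^-1.
Proof. by move=> gG; rewrite repr_mxV // det_inv. Qed.

Lemma KH_normal H : (KH rG H <| GH rG H)%g.
Proof.
apply/andP; split; first by apply/subsetP => g; rewrite mem_KH => /andP[].
apply/subsetP => x xGH; rewrite inE; apply/subsetP => _ /imsetP[y yK ->].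
move: yK; rewrite !mem_KH => /andP[yGH /eqP dy]; rewrite groupJ //=.
have xG := subsetP (GH_sub H) x xGH; have yG := subsetP (GH_sub H) y yGH.
by rewrite conjgE !repr_detM ?groupM ?groupV // dy mul1r repr_detV // mulVf ?repr_det_neq0.
Qed.

Lemma fixsp_rank_le g : (\rank (fixsp rG g) + \rank (rG g - 1%:M)%R)%N = n.
Proof. by rewrite mxrank_ker mxrank_tr subnK ?rank_leq_row. Qed.

Lemma hypsP H : H \in hyps rG -> exists2 r, r \in reflections rG & H = (<<fixsp rG r>>)%MS.
Proof.
by rewrite mem_undup => /mapP[r]; rewrite mem_enum; exists r.
Qed.

Lemma rank_hyp H : H \in hyps rG -> (\rank H).+1 = n.
Proof. by move=> /hypsP[r]; rewrite inE => /andP[_ /eqP rr] ->; rewrite mxrank_gen. Qed.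

Lemma rank_ker_hyp H : H \in hyps rG -> \rank (kermx H^T) = 1%N.
Proof. by move=> /rank_hyp hH; rewrite mxrank_ker mxrank_tr -{1}hH subSnn. Qed.

Lemma lH_neq0 H : H \in hyps rG -> lH H != 0.
Proof. by move=> hH; rewrite nz_row_eq0 -mxrank_eq0 rank_ker_hyp. Qed.

Lemma lH_eqmx H : H \in hyps rG -> (lH H :=: kermx H^T)%MS.
Proof.
move=> hH; apply/eqmxP; have := nz_row_sub (kermx H^T).
by move/mxrank_leqif_eq/geq_leqif; rewrite -/(lH H) rank_rV lH_neq0 // rank_ker_hyp.
Qed.

Lemma hyp_eqmx H : H \in hyps rG -> (H :=: kermx (lH H)^T)%MS.
Proof.
move=> hH; apply/eqmxP.
have : (H <= kermx (lH H)^T)%MS.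
  apply/sub_kermxP; apply: trmx_inj.
  by rewrite trmx_mul trmxK trmx0; apply/sub_kermxP/nz_row_sub.
move/mxrank_leqif_eq/geq_leqif <-.
by rewrite mxrank_ker mxrank_tr rank_rV lH_neq0 // -{1}(rank_hyp hH) subn1.
Qed.

Lemma sub_hypP H (v : 'rV_n) : H \in hyps rG ->
  reflect (lH H *m v^T = 0) (v <= H)%MS.
Proof.
move=> hH; rewrite (hyp_eqmx hH); apply: (iffP sub_kermxP).
  by move=> e; apply: trmx_inj; rewrite trmx_mul trmxK e trmx0.
by move=> e; apply: trmx_inj; rewrite trmx_mul trmxK e trmx0.
Qed.

(** One row space contains the other and the ranks agree; equality of matrices follows because
    [hyps] holds canonical [genmx] representatives. *)
Lemma lH_inj H H' (a : F) : H \in hyps rG -> H' \in hyps rG ->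
  lH H = a *: lH H' -> H = H'.
Proof.
move=> hH hH' e.
have /mxrank_leqif_eq/geq_leqif : (H' <= H)%MS.
  apply/row_subP => i; apply/(sub_hypP _ hH).
  by rewrite e -scalemxAl (sub_hypP _ hH' (row_sub i H')) scaler0.
have -> : \rank H = \rank H' by apply: succn_inj; rewrite !rank_hyp.
rewrite leqnn => /esym/eqmxP/eq_genmx.
by case/hypsP: hH => r _ ->; case/hypsP: hH' => r' _ ->; rewrite !genmx_id.
Qed.

(** The rows of [rG g - 1%:M] are forms vanishing on [H], hence multiples of [lH H]; the multipliers
    are the entries of [b]. *)
Lemma GH_root H g : H \in hyps rG -> g \in GH rG H ->
  exists b : 'cV_n, rG g = 1%:M + b *m lH H.
Proof.
move=> hH; rewrite inE => /andP[_ /sub_kermxP e].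
have : (rG g - 1%:M <= lH H)%MS.
  rewrite lH_eqmx //; apply/sub_kermxP; apply: trmx_inj.
  by rewrite trmx_mul trmxK e trmx0.
by case/submxP => b /eqP; rewrite subr_eq addrC => /eqP; exists b.
Qed.

Lemma det_root H g (b : 'cV_n) :
  rG g = 1%:M + b *m lH H -> \det (rG g) = 1 + (lH H *m b) 0 0.
Proof. by move=> ->; apply: det_add_col_row. Qed.

Lemma GH_transv H t : H \in hyps rG -> t \in GH rG H ->
  is_transv rG t -> (rG t - 1%:M) *m (rG t - 1%:M) = 0 /\ ((rG t - 1%:M)^T <= H)%MS.
Proof.
move=> hH; rewrite inE => /andP[tG Ht] /andP[/eqP rt tt].
split; first by apply: trmx_inj; rewrite trmx_mul (sub_kermxP tt) trmx0.
apply: submx_trans tt _; have := mxrank_leqif_eq Ht; move/geq_leqif.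
have -> : \rank H = \rank (fixsp rG t) by apply: succn_inj; rewrite rank_hyp.
by rewrite leqnn => /esym/andP[].
Qed.

(** Determinant 1 would mean that [lH H] kills the root vector, and [s] would be a transvection. *)
Lemma non_transv_det H s : H \in hyps rG -> s \in GH rG H ->
  is_refl rG s -> ~~ is_transv rG s -> \det (rG s) != 1.
Proof.
move=> hH sH rs; rewrite /is_transv rs /=; apply: contraNneq.
have [b sb] := GH_root hH sH; rewrite (det_root sb) => /eqP.
rewrite -subr_eq0 addrAC subrr add0r => lb; apply/sub_kermxP.
rewrite -trmx_mul sb addrAC subrr add0r mulmxA -(mulmxA b).
by rewrite [_ *m b]mx11_scalar (eqP lb) mul_mx_scalar scale0r mul0mx trmx0.
Qed.

Lemma det_non_transv H s : H \in hyps rG -> s \in GH rG H ->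
  \det (rG s) != 1 -> is_refl rG s && ~~ is_transv rG s.
Proof.
move=> hH sH ds; have [b sb] := GH_root hH sH.
have s1 : rG s - 1%:M = b *m lH H by rewrite sb addrAC subrr add0r.
have s10 : rG s - 1%:M != 0.
  by apply: contra ds; rewrite subr_eq0 => /eqP ->; rewrite det1.
have rs : is_refl rG s.
  have rk1 : \rank (rG s - 1%:M) = 1%N.
    apply/eqP; rewrite eqn_leq lt0n mxrank_eq0 s10 s1.
    by rewrite (leq_trans (mxrankM_maxr _ _)) // rank_leq_row.
  by apply/eqP; have := fixsp_rank_le s; rewrite rk1 addn1.
rewrite rs; apply: contra ds => ts.
have [e _] := GH_transv hH sH ts.
have {}e : b *m ((lH H *m b) *m lH H) = 0 by rewrite -e s1 !mulmxA.
rewrite (det_root sb) -subr_eq0 addrAC subrr add0r.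
move: e; rewrite {1}[lH H *m b]mx11_scalar mul_scalar_mx -scalemxAr -s1.
by move/eqP; rewrite scaler_eq0 (negbTE s10) orbF.
Qed.

(** Since [A = b *m lH H] satisfies [A *m A = (d - 1) *: A], the matrix of [s ^+ k] minus 1 is a
    geometric sum in [d] times [A]; the factor [d - 1] on the left avoids a division. *)
Lemma diag_root_expg H s b k : H \in hyps rG -> s \in GH rG H ->
  rG s = 1%:M + b *m lH H ->
  (\det (rG s) - 1) *: (rG (s ^+ k)%g - 1%:M)
    = (\det (rG s) ^+ k - 1) *: (b *m lH H).
Proof.
move=> hH sH sb; have sG := subsetP (GH_sub H) s sH.
set d := \det (rG s); set A := b *m lH H.
have AA : A *m A = (d - 1) *: A.
  rewrite /A mulmxA -(mulmxA b) [lH H *m b]mx11_scalar mul_mx_scalar -scalemxAl.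
  by rewrite /d (det_root sb) addrAC subrr add0r.
elim: k => [|k IHk]; first by rewrite repr_mx1 expr0 !subrr scaler0 scale0r.
rewrite expgS repr_mxM ?groupX // sb -/A.
set X := rG _ in IHk *.
have -> : (1%:M + A) *m X - 1%:M = (X - 1%:M) + A *m (X - 1%:M) + A.
  by rewrite mulmxDl mul1mx mulmxBr mulmx1 -[RHS]addrA subrK addrAC.
rewrite 2!scalerDr scalemxAr IHk -scalemxAr AA scalerA -!scalerDl.
by congr (_ *: _); rewrite exprS; ring.
Qed.

End Hyperplanes.

(** * The reflection s_H, its determinant, and the exponents a_H *)

Section DiagonalizableReflection.
Set Implicit Arguments.
Unset Strict Implicit.
Variables (F : fieldType) (gT : finGroupType) (G : {group gT}) (n : nat).
Variable rG : mx_representation F G n.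
Hypothesis rG_faithful : mx_faithful rG.
Implicit Types (g s t : gT) (H : 'M[F]_n).

(** Cancelling [\det (rG s) - 1] in [diag_root_expg] leaves the identity matrix. Thus the
    determinant is faithful on the powers of [s]. *)
Lemma diag_expg_eq1 H s k : H \in hyps rG -> s \in GH rG H ->
  \det (rG s) != 1 -> \det (rG s) ^+ k = 1 -> (s ^+ k = 1)%g.
Proof.
move=> hH sH d1 dk; have [b sb] := GH_root hH sH.
have sG := subsetP (GH_sub rG H) s sH.
have /eqP := diag_root_expg k hH sH sb.
rewrite dk subrr scale0r scaler_eq0 !subr_eq0 (negbTE d1) /= => /eqP e.
by apply: (mx_faithful_inj rG_faithful); rewrite ?groupX // repr_mx1.
Qed.

Lemma diag_primitive H s : H \in hyps rG -> s \in GH rG H ->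
  \det (rG s) != 1 -> #[s]%g.-primitive_root (\det (rG s)).
Proof.
move=> hH sH d1; have sG := subsetP (GH_sub rG H) s sH.
have ds : \det (rG s) ^+ #[s]%g = 1 by rewrite -repr_detX // expg_order repr_mx1 det1.
have [m dm /dvdnP _] := prim_order_exists (order_gt0 s) ds.
suff -> : #[s]%g = m by [].
apply/eqP; rewrite eqn_dvd (prim_order_dvd dm) ds eqxx andbT.
by rewrite order_dvdn (diag_expg_eq1 hH sH) ?prim_expr_order.
Qed.

(** The determinant, read off any coset representative, embeds the quotient into the multiplicative
    group of a field, where finite subgroups are cyclic. *)
Lemma cyclic_GH_KH H : cyclic (GH rG H / KH rG H)%g.
Proof.
pose f (x : coset_of (KH rG H)) := \det (rG (repr x)).
have fE y : y \in GH rG H -> f (coset (KH rG H) y) = \det (rG y).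
  move=> yH; have /rcosetP[k kK e] : repr (coset (KH rG H) y) \in (KH rG H :* y)%g.
    rewrite -val_coset ?mem_repr_coset //.
    exact: (subsetP (normal_norm (KH_normal rG H))).
  move: kK; rewrite /f e mem_KH => /andP[kH /eqP dk].
  by rewrite repr_detM ?(subsetP (GH_sub rG H)) // dk mul1r.
have mem_norm y : y \in GH rG H -> y \in 'N(KH rG H)%g.
  exact: (subsetP (normal_norm (KH_normal rG H))).
apply: (@field_mul_group_cyclic _ _ _ f).
  move=> _ _ /morphimP[x _ xH ->] /morphimP[y _ yH ->].
  rewrite -morphM ?mem_norm //= !fE ?groupM //.
  by rewrite repr_detM ?(subsetP (GH_sub rG H)).
move=> _ /morphimP[x _ xH ->]; rewrite fE //; split=> [dx|/coset_idr xK].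
  by apply: coset_id; rewrite mem_KH xH dx /=.
by apply/eqP; have := xK (mem_norm x xH); rewrite mem_KH => /andP[].
Qed.

Lemma eH_card H : eH rG H = #|GH rG H / KH rG H|%g.
Proof. by rewrite card_quotient // normal_norm // KH_normal. Qed.

(** Lift a generator of the cyclic quotient; its order does not grow, as the determinant is faithful
    on its powers. Hence [sH] takes its default value only when [eH] is 1. *)
Lemma exists_diag_generator H : H \in hyps rG -> eH rG H != 1%N ->
  exists2 s, s \in GH rG H &
    [&& is_refl rG s, ~~ is_transv rG s, #[s]%g == eH rG H
      & (<<KH rG H :|: [set s]>>%g == GH rG H)].
Proof.
move=> hH e1; have /cyclicP[x xE] := cyclic_GH_KH H.
have : x \in (GH rG H / KH rG H)%g by rewrite xE cycle_id.
case/morphimP => s sN sH xs; exists s => //.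
have sG := subsetP (GH_sub rG H) s sH.
have ord_x : #[x]%g = eH rG H by rewrite eH_card xE.
have d1 : \det (rG s) != 1.
  apply: contra e1 => ds; rewrite -ord_x order_eq1 xs.
  by apply/eqP/coset_id; rewrite mem_KH sH.
have /andP[-> ->] /= := det_non_transv hH sH d1.
apply/andP; split.
  rewrite -ord_x eqn_dvd; apply/andP; split; last first.
    by rewrite order_dvdn xs -morphX //= expg_order morph1.
  rewrite order_dvdn; apply/eqP/(diag_expg_eq1 hH sH d1).
  have : coset (KH rG H) (s ^+ #[x])%g = 1%g by rewrite morphX //= -xs expg_order.
  move/coset_idr => /(_ (groupX _ sN)); rewrite mem_KH => /andP[_ /eqP].
  by rewrite repr_detX.
rewrite eqEsubset gen_subG subUset sub1set sH (normal_sub (KH_normal rG H)) /=.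
apply/subsetP => y yH.
have yN : y \in 'N(KH rG H)%g by apply: (subsetP (normal_norm (KH_normal rG H))).
have : coset (KH rG H) y \in (GH rG H / KH rG H)%g by apply: mem_morphim.
rewrite xE => /cycleP[k]; rewrite xs -morphX //= => e.
have : y \in (KH rG H :* (s ^+ k))%g
  by rewrite -val_coset ?groupX // -e val_coset // rcoset_refl.
case/rcosetP => z zK ->.
by rewrite groupM ?groupX ?mem_gen // inE ?zK // set11 orbT.
Qed.

Lemma sH_mem H : sH rG H \in GH rG H.
Proof. by rewrite /sH; case: pickP => [s /andP[]|_] //=; apply: group1. Qed.

Lemma sH_primitive H : H \in hyps rG ->
  (eH rG H).-primitive_root (\det (rG (sH rG H))).
Proof.
move=> hH; rewrite /sH; case: pickP => [s|none] /=.
  case/andP => sH /and4P[rs ts /eqP <- _].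
  exact/(diag_primitive hH sH)/(non_transv_det hH sH).
have [->|/(exists_diag_generator hH)[s sH sP]] := eqVneq (eH rG H) 1%N.
  rewrite repr_mx1 det1; apply/andP; split=> //; apply/forallP => i.
  by rewrite ord1 unity_rootE expr1n !eqxx.
by have := none s; rewrite sH sP.
Qed.

Lemma sH_eq1 H : H \in hyps rG -> \det (rG (sH rG H)) = 1 -> sH rG H = 1%g.
Proof.
move=> hH; rewrite /sH; case: pickP => [s|] //=.
by case/and5P => sH rs ts _ _ d1; have := non_transv_det hH sH rs ts; rewrite d1 eqxx.
Qed.

Lemma lin_char1 psi : lin_char G psi -> psi 1%g = 1 :> F.
Proof.
move=> [psiM psi0]; apply: (mulfI (psi0 _ (group1 G))).
by rewrite -psiM ?group1 // mulg1 mulr1.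
Qed.

Lemma lin_charX psi g k : lin_char G psi -> g \in G ->
  psi (g ^+ k)%g = psi g ^+ k :> F.
Proof.
move=> pl gG; elim: k => [|k IHk]; first exact: lin_char1.
by rewrite expgS exprS pl.1 ?groupX // IHk.
Qed.

Lemma lin_char_mul_det psi : lin_char G psi ->
  lin_char G (fun g => psi g * \det (rG g)).
Proof.
move=> [psiM psi0]; split=> [x y xG yG|x xG].
  by rewrite psiM // repr_detM // mulrACA.
by rewrite mulf_neq0 ?psi0 ?repr_det_neq0.
Qed.

Lemma order_sH_det H : H \in hyps rG -> (sH rG H ^+ eH rG H = 1)%g.
Proof.
move=> hH; have [d1|d1] := eqVneq (\det (rG (sH rG H))) 1.
  by rewrite (sH_eq1 hH d1) expg1n.
by rewrite (diag_expg_eq1 hH (sH_mem H)) // prim_expr_order // sH_primitive.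
Qed.

(** The inverse of [psi] at s_H is an e_H-th root of unity, so it is a power of the primitive root
    [d] with exponent below e_H, hence below [#|G|]. The search in [aH] therefore succeeds. *)
Lemma aH_spec H psi : H \in hyps rG -> lin_char G psi ->
  psi (sH rG H) = (\det (rG (sH rG H))) ^- aH rG psi H /\
  forall k, (k < aH rG psi H)%N -> psi (sH rG H) != (\det (rG (sH rG H))) ^- k.
Proof.
move=> hH pl; set s := sH rG H; set d := \det (rG s).
have sG : s \in G := subsetP (GH_sub rG H) s (sH_mem H).
have dp := sH_primitive hH; rewrite -/s -/d in dp.
have [i iE] : {i : 'I_(eH rG H) | (psi s)^-1 = d ^+ i}.
  by apply: (prim_rootP dp); rewrite exprVn -lin_charX // order_sH_det // lin_char1 // invr1.
have eG : (eH rG H <= #|G|)%N.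
  rewrite eH_card (leq_trans (leq_quotient _ _)) //.
  exact/subset_leq_card/GH_sub.
have iP : has (fun a => psi s == d ^- a) (iota 0 #|G|.+1).
  apply/hasP; exists (i : nat); last by rewrite -iE invrK.
  by rewrite mem_iota /= add0n ltnS (leq_trans (ltnW (ltn_ord i))).
have aL : (aH rG psi H < #|G|.+1)%N.
  by move: iP; rewrite has_find size_iota.
split=> [|k kL].
  by apply/eqP; have := nth_find 0%N iP; rewrite -/(aH rG psi H) nth_iota.
by have := before_find 0%N kL; rewrite nth_iota ?(ltn_trans kL) // add0n => ->.
Qed.

End DiagonalizableReflection.

(** * Bounding a determinant from below by contraction with a basis *)

Section AdaptedBasis.
Set Implicit Arguments.
Unset Strict Implicit.
Variables (F : fieldType) (n : nat).
Notation cmx := (map_mx (@mpolyC n F)).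

(** Changing to the basis formed by [K] and [R] multiplies [\det W] by a nonzero constant; the
    columns from [R] get exponent 0. *)
Lemma divides_det_basis N m r (e : (m + r = N)%N) (K : 'M[F]_(m, N))
    (R : 'M_(r, N)) (W : 'M_N) p (k : 'I_m -> nat) :
  row_full (col_mx K R) ->
  (forall i j, divides (p ^+ k j) ((W *m cmx K^T) i j)) ->
  divides (p ^+ (\sum_j k j)) (\det W).
Proof.
(* Replacing [N] by [m + r] makes [col_mx K R] a square matrix, so that it has a determinant. *)
case: N / e K R W => K R W KRfull pW.
pose P := col_mx K R; pose k' (j : 'I_(m + r)) := if split j is inl i then k i else 0%N.
have detP : \det P != 0 by rewrite -unitfE -unitmxE -row_full_unit.
have [q qE] : divides (p ^+ (\sum_j k' j)) (\det (W *m cmx P^T)).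
  apply: divides_det => i j; rewrite /P tr_col_mx map_row_mx mul_mx_row.
  rewrite mxE /k'; case: split => j' //; rewrite expr0; exact: divides1.
have -> : (\sum_j k j = \sum_j k' j)%N.
  rewrite big_split_ord /= [X in (_ + X)%N]big1 ?addn0 => [|j _].
    by apply: eq_bigr => j _; rewrite /k' (unsplitK (inl _ j)).
  by rewrite /k' (unsplitK (inr _ j)).
exists ((\det P)^-1%:MP * q); rewrite -mulrA -qE det_mulmx det_map_mx det_tr.
by rewrite mulrCA -mpolyCM mulVf // mpolyC1 mulr1.
Qed.

(** Take a basis of [C], then [u], then a basis of a complement. It is applied with [C] the
    hyperplane or the span of the transvection root vectors. *)
Lemma divides_det_flag (C : 'M[F]_n) (u : 'cV_n) (W : 'M_n) p k1 k2 :
  ~~ (u^T <= C)%MS ->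
  (forall v : 'rV_n, (v <= C)%MS -> forall i, divides (p ^+ k1) ((W *m cmx v^T) i 0)) ->
  (forall i, divides (p ^+ k2) ((W *m cmx u) i 0)) ->
  divides (p ^+ (k1 * \rank C + k2)) (\det W).
Proof.
move=> uC pC pu; pose K := col_mx (row_base C) u^T.
have rank_u : \rank u^T = 1%N.
  by rewrite rank_rV; case: eqP uC => // ->; rewrite sub0mx.
have rK : \rank K = (\rank C + 1)%N.
  apply/eqP; rewrite eqn_leq rank_leq_row /= [leqLHS]addn1.
  suff : (C < K)%MS by rewrite ltmxErank => /andP[].
  rewrite /ltmx -!addsmxE; apply/andP; split.
    by rewrite (submx_trans _ (addsmxSl _ _)) // eq_row_base.
  by apply: contra uC => CK; apply: submx_trans CK; apply: addsmxSr.
have e : (\rank C + 1 + \rank K^C = n)%N.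
  by rewrite mxrank_compl rK subnKC // -rK rank_leq_col.
have Kfull : row_full (col_mx K (row_base K^C)%MS).
  rewrite -sub1mx -addsmxE.
  have := addsmx_compl_full K; rewrite -sub1mx => K1.
  by rewrite (submx_trans K1) // addsmxS // eq_row_base.
pose k (j : 'I_(\rank C + 1)) := if split j is inl _ then k1 else k2.
have -> : (k1 * \rank C + k2 = \sum_j k j)%N.
  rewrite big_split_ord big_ord1 /= mulnC; congr (_ + _)%N.
    rewrite -[X in (X * _)%N](card_ord (\rank C)) -sum_nat_const.
    by apply: eq_bigr => j _; rewrite /k (unsplitK (inl _ j)).
  by rewrite /k (unsplitK (inr _ ord0)).
apply: (divides_det_basis e Kfull) => i j.
rewrite /K tr_col_mx trmxK map_row_mx mul_mx_row mxE /k; case: split => j'.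
  have := pC (row j' (row_base C)) _ i; rewrite (submx_trans (row_sub _ _)) ?eq_row_base //.
  move/(_ isT); congr (divides _ _); rewrite !mxE; apply: eq_bigr => t _.
  by rewrite !mxE.
by have := pu i; rewrite ord1.
Qed.

End AdaptedBasis.

(** * Action on polynomials and forms modulo l_H *)

Section InvariantForms.
Set Implicit Arguments.
Unset Strict Implicit.
Variables (F : fieldType) (gT : finGroupType) (G : {group gT}) (n : nat).
Variable rG : mx_representation F G n.
Hypothesis rG_faithful : mx_faithful rG.
Implicit Types (g s t : gT) (H : 'M[F]_n) (p : {mpoly F[n]}).
Notation cmx := (map_mx (@mpolyC n F)).

Lemma actpM g p q : actp rG g (p * q) = actp rG g p * actp rG g q.
Proof. exact: (rmorphM (subst (rG g^-1%g))). Qed.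

Lemma actp_mod H g p : H \in hyps rG -> g \in GH rG H ->
  divides (lpoly (lH H)) (actp rG g p - p).
Proof.
move=> hH gH; have [b gb] := GH_root hH (groupVr gH).
by rewrite -[actp rG g p]/(subst (rG g^-1%g) p) gb; apply: subst_mod.
Qed.

Lemma actp_lH H g : H \in hyps rG -> g \in GH rG H ->
  actp rG g (lpoly (lH H)) = (\det (rG g))^-1 *: lpoly (lH H).
Proof.
move=> hH gH; have [b gb] := GH_root hH (groupVr gH).
rewrite -[LHS]/(subst (rG g^-1%g) _) subst_lpoly -repr_detV ?(subsetP (GH_sub rG H)) //.
rewrite (det_root gb) gb mulmxDr mulmx1 mulmxA [lH H *m b]mx11_scalar.
by rewrite mul_scalar_mx -{1}[lH H]scale1r -scalerDl lpolyZ !mxE.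
Qed.

(* If g fixes p up to a scalar mu <> 1 then (mu - 1) p = g p - p vanishes on H;
   dividing by l_H shifts the exponent by one. *)
Lemma divides_semi_invariant H g p m : H \in hyps rG -> g \in GH rG H ->
  actp rG g p = (\det (rG g)) ^- m *: p ->
  (forall k, (0 < k <= m)%N -> \det (rG g) ^+ k != 1) ->
  divides (lpoly (lH H) ^+ m) p.
Proof.
move=> hH gH; set d := \det (rG g).
have d0 : d != 0 by rewrite repr_det_neq0 // (subsetP (GH_sub rG H)).
have L0 : lpoly (lH H) != 0 by rewrite lpoly_eq0 (lH_neq0 hH).
elim: m p => [|m IHm] p gp dk; first by rewrite expr0; apply: divides1.
have c0 : d ^- m.+1 - 1 != 0.
  by rewrite subr_eq0 invr_eq1 dk /=.
have [q qE] := actp_mod p hH gH; rewrite gp -{2}[p]scale1r -scalerBl in qE.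
have {}qE : p = (d ^- m.+1 - 1)^-1 *: q * lpoly (lH H).
  by rewrite -scalerAl -qE scalerA mulVf // scale1r.
set p' := _ *: q in qE.
have [r rE] : divides (lpoly (lH H) ^+ m) p'; last first.
  by exists r; rewrite qE rE exprSr mulrA.
apply: IHm => [|k /andP[k0 km]]; last by rewrite dk // k0 leqW.
apply: (mulIf L0).
have : actp rG g (p' * lpoly (lH H)) = d ^- m.+1 *: (p' * lpoly (lH H)).
  by rewrite -qE.
rewrite actpM actp_lH // -/d => e.
rewrite -scalerAl -[LHS](scale1r) -(mulfV d0) -scalerA scalerAr e scalerA.
by rewrite exprS invfM mulrA mulfV // mul1r.
Qed.

(** This is the rule (g w)(u) = g(w(g^-1 u)), evaluated at an eigenvector of g^-1. *)
Lemma actf_eigenvector g (chi : gT -> F) (w : 'rV_n) (u : 'cV[F]_n) (mu : F) :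
  actf rG g w = (chi g)%:MP *: w -> rG g^-1%g *m u = mu *: u ->
  mu *: actp rG g ((w *m cmx u) 0 0) = chi g *: (w *m cmx u) 0 0.
Proof.
move=> gw gu.
have e1 : actf rG g w *m cmx u = map_mx (actp rG g) w *m cmx (rG g^-1%g *m u).
  by rewrite /actf map_mxM mulmxA.
move: e1; rewrite gw gu map_mxZ -scalemxAl -scalemxAr => /matrixP/(_ 0 0).
rewrite [LHS]mxE [RHS]mxE !mul_mpolyC => ->; congr (_ *: _).
rewrite -[cmx u in RHS](subst_cmx (rG g^-1%g)).
by rewrite -[actp rG g]/(subst (rG g^-1%g)) -map_mxM [RHS]mxE.
Qed.

Lemma actf_mod H g (w : 'rV_n) k (A : 'M[F]_(n, k)) : H \in hyps rG -> g \in GH rG H ->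
  forall i j, divides (lpoly (lH H)) (((map_mx (actp rG g) w - w) *m cmx A) i j).
Proof.
by move=> hH gH; apply: divides_mulmx => i j; rewrite !mxE; apply: actp_mod.
Qed.

(** Let [w'] be [w] with [t] applied to its coefficients, so [w'] is congruent to [w] modulo l_H. As
    [A] squares to zero, t^-1 fixes the columns of [A], and contracting the invariance equation with
    [A] gives [w' A = chi(t) w A]. *)
Lemma transv_divides H t (chi : gT -> F) (w : 'rV_n) :
  H \in hyps rG -> t \in GH rG H -> is_transv rG t ->
  actf rG t w = (chi t)%:MP *: w ->
  forall i j, divides (lpoly (lH H)) ((w *m cmx (rG t - 1%:M)) i j).
Proof.
move=> hH tH tt tw i j; have tG := subsetP (GH_sub rG H) t tH.
set A := rG t - 1%:M; have [AA _] := GH_transv hH tH tt.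
have tV : rG t^-1%g = 1%:M - A.
  have tu := repr_mx_unit rG tG.
  rewrite repr_mxV // -[invmx _]mulmx1; apply: (canLR (mulKmx tu)).
  by rewrite -[rG t](subrK 1%:M) -/A mulmxDl mul1mx mulmxBr AA mulmx1 subr0 addrC subrK.
have tVA : rG t^-1%g *m A = A by rewrite tV mulmxBl mul1mx AA subr0.
set L := lpoly _; set w' := map_mx (actp rG t) w in tw.
have modL : forall i j, divides L (((w' - w) *m cmx A) i j) by apply: actf_mod.
have e : w' *m cmx A = (chi t)%:MP *: (w *m cmx A).
  by rewrite scalemxAl -tw /actf -mulmxA -map_mxM tVA.
have d1 : divides L ((chi t - 1)%:MP * (w *m cmx A) i j).
  have := modL i j; rewrite mulmxBl e -{2}[w *m _]scale1r -scalerBl.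
  by rewrite mxE mpolyCB mpolyC1.
(* If [chi t] is not 1, the constant [chi t - 1] can be cancelled from [d1]. If it is 1, then [d1]
   says nothing, and invariance in the form [w' (1 - A) = w] is used instead. *)
have [chi1|chi1] := eqVneq (chi t) 1; last first.
  have c0 : chi t - 1 != 0 by rewrite subr_eq0.
  have -> : (w *m cmx A) i j = (chi t - 1)^-1%:MP * ((chi t - 1)%:MP * (w *m cmx A) i j).
    by rewrite mulrA -mpolyCM mulVf // mpolyC1 mul1r.
  exact: dividesMl.
have wA : w *m cmx A = w' *m cmx A.
  by rewrite e chi1 mpolyC1 scale1r.
have -> : w *m cmx A = w' - w.
  move: tw; rewrite chi1 mpolyC1 scale1r /actf -/w' tV map_mxB map_mx1.
  by rewrite mulmxBr mulmx1 -wA => {2}<-; rewrite opprB addrCA subrr addr0.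
by rewrite !mxE; apply: actp_mod.
Qed.

End InvariantForms.

(** * The power of l_H dividing the determinant of chi-invariant forms *)

Section LocalDivisibility.
Set Implicit Arguments.
Unset Strict Implicit.
Variables (F : fieldType) (gT : finGroupType) (G : {group gT}) (n : nat).
Variable rG : mx_representation F G n.
Hypothesis rG_faithful : mx_faithful rG.
Variables (H : 'M[F]_n) (chi : gT -> F).
Hypotheses (hH : H \in hyps rG) (chi_lin : lin_char G chi).
Implicit Types (p : {mpoly F[n]}) (W : 'M[{mpoly F[n]}]_n).
Notation cmx := (map_mx (@mpolyC n F)).
Notation s := (sH rG H).
Notation L := (lpoly (lH H)).

Lemma sH_mem_group : s \in G.
Proof. exact: subsetP (GH_sub rG H) _ (sH_mem rG H). Qed.

(** If the determinant of s_H had a trivial k-th power with [0 < k <= aH], then [aH - k] would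
    contradict the minimality of [aH]. *)
Lemma divides_aH psi p : lin_char G psi ->
  actp rG s p = psi s *: p -> divides (L ^+ aH rG psi H) p.
Proof.
move=> pl sp; have [e lt_a] := aH_spec rG_faithful hH pl.
rewrite e in sp; apply: (divides_semi_invariant hH (sH_mem rG H) sp) => k /andP[k0 ka].
have := lt_a (aH rG psi H - k)%N; rewrite ltn_subrL k0 (leq_trans k0 ka).
move/(_ isT); apply: contra => /eqP dk; rewrite e.
by rewrite -{1}(subnK ka) exprD dk mulr1.
Qed.

Lemma aH_eq0 psi : lin_char G psi -> psi s = 1 -> aH rG psi H = 0%N.
Proof.
move=> pl s1; have [_ lt_a] := aH_spec rG_faithful hH pl.
by case: (posnP (aH rG psi H)) => // /lt_a; rewrite s1 expr0 invr1 eqxx.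
Qed.

(** Writing [p = q * L], the quotient satisfies [s q = d q = d ^- (e_H - 1) q], and [d] has order
    e_H, so [q] is divisible by [L] to the power e_H - 1. *)
Lemma divides_eH p : actp rG s p = p -> divides L p -> divides (L ^+ eH rG H) p.
Proof.
have dp := sH_primitive rG_faithful hH; have e0 := prim_order_gt0 dp.
move: dp; set d := \det _ => dp sp [q qE].
have L0 : L != 0 by rewrite lpoly_eq0 (lH_neq0 hH).
have d0 : d != 0 by rewrite repr_det_neq0 ?sH_mem_group.
suff [r rE] : divides (L ^+ (eH rG H).-1) q.
  by exists r; rewrite qE rE -mulrA -exprSr prednK.
apply: (divides_semi_invariant hH (sH_mem rG H)); rewrite -/d; last first.
  move=> k /andP[k0 ke]; rewrite -(prim_order_dvd dp) gtnNdvd //.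
  by rewrite -(prednK e0) ltnS.
apply: (mulIf L0); rewrite -scalerAl -qE -sp qE actpM actp_lH ?sH_mem // -/d.
by rewrite -scalerAr scalerA -invfM -exprSr prednK // prim_expr_order // invr1 scale1r.
Qed.

Variable W : 'M[{mpoly F[n]}]_n.
Hypothesis W_inv : forall i, chi_invariant_form rG chi (row i W).

Lemma contract_rowE k (u : 'M[F]_(n, k)) i j :
  (W *m cmx u) i j = (row i W *m cmx u) 0 j.
Proof. by rewrite -row_mul [RHS]mxE. Qed.

Lemma actp_contract_hyp (v : 'rV_n) i : (v <= H)%MS ->
  actp rG s ((W *m cmx v^T) i 0) = chi s *: (W *m cmx v^T) i 0.
Proof.
move=> /(sub_hypP _ hH) lv; rewrite contract_rowE -[LHS]scale1r.
apply: actf_eigenvector; first exact: W_inv sH_mem_group.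
have [b ->] := GH_root hH (groupVr (sH_mem rG H)).
by rewrite mulmxDl mul1mx -mulmxA lv mulmx0 addr0 scale1r.
Qed.

Lemma divides_contract_transv (v : 'rV_n) i :
  (v <= \sum_(t in GH rG H | is_transv rG t) (rG t - 1%:M)^T)%MS ->
  divides L ((W *m cmx v^T) i 0).
Proof.
case/sub_sumsmxP => u ->; rewrite linear_sum /= map_mx_sum mulmx_sumr summxE.
apply: divides_sum => t /andP[tH tt].
rewrite trmx_mul trmxK map_mxM mulmxA; apply: divides_mulmx => i' j'.
rewrite contract_rowE; apply: (transv_divides hH tH tt).
exact/W_inv/(subsetP (GH_sub rG H)).
Qed.

(** If s_H is trivial the exponent is 0 and any vector off [H] works. Otherwise the root vector [b]
    of s_H is an eigenvector for [\det (rG s)], and it lies off [H] because [lH H] takes the value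
    [\det (rG s) - 1] on it. *)
Lemma exists_transverse_vector : exists2 u : 'cV[F]_n, ~~ (u^T <= H)%MS &
  forall i, divides (L ^+ aH rG (fun g => chi g * \det (rG g)) H) ((W *m cmx u) i 0).
Proof.
have clin := lin_char_mul_det rG chi_lin.
have [d1|d1] := eqVneq (\det (rG s)) 1.
  have s1 := sH_eq1 hH d1.
  have [u lu] := exists_dual_vector (lH_neq0 hH); exists u => [|i].
    apply/negP => /(sub_hypP _ hH)/eqP; rewrite trmxK lu.
    by move/eqP/matrixP/(_ 0 0)/eqP; rewrite !mxE oner_eq0.
  rewrite aH_eq0 //; first by rewrite expr0; apply: divides1.
  by rewrite d1 mulr1 s1 (lin_char1 chi_lin).
have [b sb] := GH_root hH (sH_mem rG H).
have lb : lH H *m b = (\det (rG s) - 1)%:M.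
  by rewrite (det_root sb) addrAC subrr add0r -mx11_scalar.
exists b => [|i].
  apply/negP => /(sub_hypP _ hH)/eqP; rewrite trmxK lb.
  by move/eqP/matrixP/(_ 0 0)/eqP; rewrite !mxE mulr1n subr_eq0 (negbTE d1).
have d0 : \det (rG s) != 0 by rewrite repr_det_neq0 ?sH_mem_group.
apply: divides_aH => //; rewrite mulrC -scalerA contract_rowE.
rewrite -(actf_eigenvector (mu := (\det (rG s))^-1) (g := s) (rG := rG)).
- by rewrite scalerA mulfV // scale1r.
- exact: W_inv sH_mem_group.
have sb' : rG s *m b = \det (rG s) *: b.
  rewrite {1}sb mulmxDl mul1mx -mulmxA lb mul_mx_scalar.
  by rewrite -{1}[b]scale1r -scalerDl addrC subrK.
rewrite repr_mxV ?sH_mem_group //.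
apply: (canLR (mulKmx (repr_mx_unit rG sH_mem_group))).
by rewrite -scalemxAr sb' scalerA mulVf // scale1r.
Qed.

Lemma divides_det_hyp :
  divides (L ^+ ((if chi s == 1 then eH rG H * bH rG H else 0)
    + (aH rG chi H * (n - 1) + aH rG (fun g => chi g * \det (rG g)) H))) (\det W).
Proof.
have [u uH Lu] := exists_transverse_vector.
have [chi1|chi1] := eqVneq (chi s) 1.
  (* Here a_H(chi) = 0, so the flag starts with the span of the transvection root vectors, of rank
     [bH], each contributing e_H. *)
  rewrite (aH_eq0 chi_lin chi1) mul0n add0n.
  have BH : (\sum_(t in GH rG H | is_transv rG t) (rG t - 1%:M)^T <= H)%MS.
    by apply/sumsmx_subP => t /andP[tH tt]; have [] := GH_transv hH tH tt.
  apply: (divides_det_flag (u := u)) => // [|v vB i].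
    by apply: contra uH => /submx_trans; apply.
  apply: divides_eH; last exact: divides_contract_transv.
  by rewrite actp_contract_hyp ?(submx_trans vB) // chi1 scale1r.
(* Now the flag starts with [H] itself, whose n - 1 basis vectors contribute a_H(chi) each. *)
rewrite add0n; have -> : (n - 1 = \rank H)%N by rewrite -[X in (X - _)%N](rank_hyp hH) subn1.
apply: (divides_det_flag (u := u)) => // v vH i.
by apply: divides_aH => //; apply: actp_contract_hyp.
Qed.

End LocalDivisibility.

(** * Assembling the hyperplanes, and the basis theorem *)

Section Global.
Set Implicit Arguments.
Unset Strict Implicit.
Variables (F : fieldType) (gT : finGroupType) (G : {group gT}) (n : nat).
Variable rG : mx_representation F G n.

Lemma wedge_discriminantE (chi : gT -> F) :
  Qtilde rG chi * Qpsi rG chi ^+ (n - 1)%N * Qpsi rG (fun g => chi g * \det (rG g))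
  = \prod_(H <- hyps rG) lpoly (lH H) ^+
      ((if chi (sH rG H) == 1 then eH rG H * bH rG H else 0)
       + (aH rG chi H * (n - 1) + aH rG (fun g => chi g * \det (rG g)) H)).
Proof.
rewrite /Qtilde /Qpsi big_mkcond -prodrXl -mulrA -!big_split; apply: eq_bigr => H _ /=.
by rewrite -exprM -exprD; case: ifP => _; rewrite ?mul1r // -exprD.
Qed.

Lemma discriminant_neq0 (chi : gT -> F) :
  Qtilde rG chi * Qpsi rG chi ^+ (n - 1)%N * Qpsi rG (fun g => chi g * \det (rG g))
  != 0.
Proof.
rewrite wedge_discriminantE big_seq prodf_seq_neq0; apply/allP => H hH.
by apply/implyP => _; rewrite expf_neq0 // lpoly_eq0 (lH_neq0 hH).
Qed.

Lemma discriminant_divides_det (chi : gT -> F) (W : 'M_n) :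
  mx_faithful rG -> lin_char G chi ->
  (forall i, chi_invariant_form rG chi (row i W)) ->
  divides (Qtilde rG chi * Qpsi rG chi ^+ (n - 1)%N
           * Qpsi rG (fun g => chi g * \det (rG g))) (\det W).
Proof.
move=> rGf chil Winv; rewrite wedge_discriminantE.
apply: divides_prod_lpoly => [|H hH|H H' hH hH' a|H hH].
- exact: undup_uniq.
- exact: lH_neq0 hH.
- exact: lH_inj hH hH'.
- exact: (divides_det_hyp rGf hH chil Winv).
Qed.

End Global.

(* The n 1-forms omega_1..omega_n are the rows of W; their wedge product is
   \det W dz_1 /\ ... /\ dz_n. *)
Theorem theorem7p3 (F : fieldType) (gT : finGroupType) (G : {group gT})
  (n : nat) (rG : mx_representation F G n) (chi : gT -> F)
  (W : 'M[{mpoly F[n]}]_n) (c : F) :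
  ~~ (2%N \in [pchar F]) ->
  mx_faithful rG ->
  (G :=: <<reflections rG>>)%g ->
  lin_char G chi ->
  (forall i, chi_invariant_form rG chi (row i W)) ->
  c != 0 ->
  \det W = c *: (Qtilde rG chi * Qpsi rG chi ^+ (n - 1)%N
                 * Qpsi rG (fun g => chi g * \det (rG g))) ->
  (forall w, chi_invariant_form rG chi w ->
     exists f : 'rV[{mpoly F[n]}]_n, (forall i, G_invariant_poly rG (f 0 i)) /\ w = f *m W)
  /\ (forall f : 'rV[{mpoly F[n]}]_n, (forall i, G_invariant_poly rG (f 0 i)) ->
        f *m W = 0 -> f = 0).
Proof.
move=> _ rGf _ chil Winv c0; have := discriminant_neq0 rG chi.
have := @discriminant_divides_det _ _ _ _ rG chi _ rGf chil.
set Q := (X in X != 0) => Qdvd Q0 detW.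
have detW0 : \det W != 0 by rewrite detW scaler_eq0 negb_or c0.
(* Stated for arbitrary polynomial coefficients, since it is reused below before the coefficients
   are known to be invariant. *)
have Wfree (f : 'rV_n) : f *m W = 0 -> f = 0.
  move=> fW; have : f *m W *m \adj W = 0 by rewrite fW mul0mx.
  rewrite -mulmxA mul_mx_adj mul_mx_scalar => /eqP.
  by rewrite scalemx_eq0 (negbTE detW0) => /eqP.
split=> [w winv|f _]; last exact: Wfree.
have /fin_all_exists[f fE] i : exists fi, (w *m \adj W) 0 i = fi * \det W.
  (* Cramer's rule: the rows of [Wi] are again chi-invariant, so [Q], and with it [\det W], divides
     [\det Wi]. *)
  pose Wi := \matrix_(k, j) if k == i then w 0 j else W k j.
  have rowWi k : row k Wi = if k == i then w else row k W.
    by apply/rowP => j; rewrite !mxE; case: ifP; rewrite ?mxE.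
  have -> : (w *m \adj W) 0 i = \det Wi.
    rewrite (expand_det_row _ i) mxE; apply: eq_bigr => j _.
    rewrite !mxE eqxx; congr (_ * (_ * \det _)).
    by apply/matrixP => k l; rewrite !mxE eq_sym (negbTE (neq_lift _ _)).
  have [|q ->] := Qdvd Wi; first by move=> k; rewrite rowWi; case: ifP.
  exists (c^-1 *: q); rewrite detW -scalerAr -scalerAl scalerA.
  by rewrite mulfV // scale1r.
pose f' := \row_i f i.
have wE : w = f' *m W.
  have e : w *m \adj W = \det W *: f' by apply/rowP => i; rewrite fE !mxE mulrC.
  have : w *m \adj W *m W = \det W *: (f' *m W) by rewrite e scalemxAl.
  rewrite -mulmxA mul_adj_mx mul_mx_scalar => /eqP.
  rewrite -subr_eq0 -scalerBr scalemx_eq0 (negbTE detW0) subr_eq0.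
  by move/eqP.
exists f'; split=> // i g gG.
have chi0 : (chi g)%:MP != 0 :> {mpoly F[n]} by rewrite mpolyC_eq0 chil.2.
(* Applying [g] to [w = f' *m W] and cancelling [chi g] shows that [f'] and its image under [g] have
   the same product with [W]; [Wfree] then identifies them. *)
suff /rowP/(_ i) : map_mx (actp rG g) f' = f' by rewrite mxE.
have Wg : map_mx (actp rG g) W *m map_mx (fun a : F => a%:MP) (rG g^-1%g)
    = (chi g)%:MP *: W.
  apply/row_matrixP => k; rewrite row_mul -map_row.
  by rewrite -[LHS]/(actf rG g (row k W)) Winv // linearZ.
have wg := winv g gG; apply/eqP; rewrite -subr_eq0; apply/eqP/Wfree.
apply/eqP; rewrite mulmxBl subr_eq0 -wE; apply/eqP.
have /eqP : (chi g)%:MP *: w = (chi g)%:MP *: (map_mx (actp rG g) f' *m W).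
  rewrite -wg {1}wE /actf -[map_mx _ (f' *m W)]/(map_mx (subst (rG g^-1%g)) _).
  by rewrite map_mxM -mulmxA [X in _ *m X]Wg -scalemxAr.
by rewrite -subr_eq0 -scalerBr scalemx_eq0 (negbTE chi0) subr_eq0 => /eqP.
Qed.
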